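(* Let $U=\begin{bmatrix} c_{RR} & c_{LR}\\ c_{RL} & c_{LL}\end{bmatrix}\in \mathrm{U}(2)$ with $c_{RR}\neq0$, let $\gamma,\delta\in\mathbb{R}$, and let $X_t^{(II)}$ be the Type II quantum walk with coin $U$, reflection phase $\gamma$ and initial state $\Psi_0^{(II)}=e^{i\delta}|0,L\rangle$. Put $b=\overline{c_{LR}}\,\Delta\, e^{-i\gamma}$, $\rho=\sqrt{1-|b|^2}$, $\nu^{(II)}(b)=\rho/|1+b|$ and $$M(b)=\bigl\{1+\mathrm{sgn}(|b|^2+\mathrm{Re}(b))\bigr\}\left|\frac{|b|^2+\mathrm{Re}(b)}{(1+b)^2}\right|.$$ Then for every $x\in\{0,1,2,\dots\}$, as $t\to\infty$, $$P(X_t^{(II)}=x)-\frac{1+(-1)^{x+t}}{2}\times\begin{cases}|M(b)|^2, & x=0,\\ |M(b)|^2\bigl(1+\nu^{(II)}(b)^{-2}\bigr)\,\nu^{(II)}(b)^{2x}, & x>0,\end{cases}\ \longrightarrow\ 0.$$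
   Context: For the coin $U$: $\Delta=\det U$; $\mathrm{sgn}(x)=1,0,-1$ for $x>0,x=0,x<0$. Type II quantum walk: the Hilbert space $\mathcal{H}^{(II)}$ has orthonormal basis $\{|0,L\rangle\}\cup\{|x,R\rangle,|x,L\rangle: x\ge1\}$; the unitary evolution $W^{(II,U)}$ is defined by $W|0,L\rangle=e^{i\gamma}|1,R\rangle$ and, for $x\ge1$, $W|x,R\rangle=c_{RR}|x+1,R\rangle+c_{LR}|x-1,L\rangle$, $W|x,L\rangle=c_{RL}|x+1,R\rangle+c_{LL}|x-1,L\rangle$ (with $|0,L\rangle$ as $|x-1,L\rangle$ when $x=1$). $P(X_t^{(II)}=x)=\sum_e|\langle e,(W^{(II,U)})^t\Psi_0^{(II)}\rangle|^2$, summed over basis vectors $e$ at position $x$ (only $|0,L\rangle$ for $x=0$; $|x,R\rangle,|x,L\rangle$ for $x\ge1$). *)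

(* Defs.v *)
From Stdlib Require Import Reals Lra.
Open Scope R_scope.

Definition Cx : Type := (R * R)%type.
Definition Cre (z : Cx) : R := fst z.
Definition Cim (z : Cx) : R := snd z.
Definition RtoC (r : R) : Cx := (r, 0).
Definition C0 : Cx := (0, 0).
Definition C1 : Cx := (1, 0).
Definition Cadd (z w : Cx) : Cx := (fst z + fst w, snd z + snd w).
Definition Copp (z : Cx) : Cx := (- fst z, - snd z).
Definition Csub (z w : Cx) : Cx := Cadd z (Copp w).
Definition Cmul (z w : Cx) : Cx :=
  (fst z * fst w - snd z * snd w, fst z * snd w + snd z * fst w).
Definition Cconj (z : Cx) : Cx := (fst z, - snd z).
Definition Cnorm2 (z : Cx) : R := fst z * fst z + snd z * snd z.
Definition Cmod (z : Cx) : R := sqrt (Cnorm2 z).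
Definition Cinv (z : Cx) : Cx := (fst z / Cnorm2 z, - snd z / Cnorm2 z).
Definition Cdiv (z w : Cx) : Cx := Cmul z (Cinv w).
Definition Cexpi (theta : R) : Cx := (cos theta, sin theta).

Definition unitary2 (cRR cLR cRL cLL : Cx) : Prop :=
  Cadd (Cmul (Cconj cRR) cRR) (Cmul (Cconj cRL) cRL) = C1 /\
  Cadd (Cmul (Cconj cLR) cLR) (Cmul (Cconj cLL) cLL) = C1 /\
  Cadd (Cmul (Cconj cRR) cLR) (Cmul (Cconj cRL) cLL) = C0 /\
  Cadd (Cmul cRR (Cconj cRR)) (Cmul cLR (Cconj cLR)) = C1 /\
  Cadd (Cmul cRL (Cconj cRL)) (Cmul cLL (Cconj cLL)) = C1 /\
  Cadd (Cmul cRR (Cconj cRL)) (Cmul cLR (Cconj cLL)) = C0.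

Definition detU (cRR cLR cRL cLL : Cx) : Cx := Csub (Cmul cRR cLL) (Cmul cLR cRL).

Definition sgn (x : R) : R :=
  match Rlt_dec 0 x with
  | left _ => 1
  | right _ => match Rlt_dec x 0 with left _ => -1 | right _ => 0 end
  end.

(* A state of H^(II) is a pair (psiR, psiL) of amplitude functions on nat:
   psiL x = <x,L|psi> (x >= 0), psiR x = <x,R|psi> (x >= 1); psiR 0 is
   unused (the basis has no |0,R>) and is kept equal to 0. *)
Definition state : Type := ((nat -> Cx) * (nat -> Cx))%type.

(* One application of W^(II,U) with reflection phase gamma:
   W|0,L> = e^{i gamma}|1,R>,
   W|x,R> = cRR|x+1,R> + cLR|x-1,L>,  W|x,L> = cRL|x+1,R> + cLL|x-1,L>  (x>=1). *)
Definition stepII (cRR cLR cRL cLL : Cx) (gamma : R) (psi : state) : state :=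
  let (pR, pL) := psi in
  ( fun y => match y with
             | O => C0
             | S O => Cmul (Cexpi gamma) (pL O)
             | S y' => Cadd (Cmul cRR (pR y')) (Cmul cRL (pL y'))
             end,
    fun y => Cadd (Cmul cLR (pR (S y))) (Cmul cLL (pL (S y))) ).

Definition psi0II (delta : R) : state :=
  (fun _ => C0, fun y => match y with O => Cexpi delta | S _ => C0 end).

Definition psiII (cRR cLR cRL cLL : Cx) (gamma delta : R) (t : nat) : state :=
  Nat.iter t (stepII cRR cLR cRL cLL gamma) (psi0II delta).

Definition probII (cRR cLR cRL cLL : Cx) (gamma delta : R) (t x : nat) : R :=
  let (pR, pL) := psiII cRR cLR cRL cLL gamma delta t in
  match x with
  | O => Cnorm2 (pL O)
  | S _ => Cnorm2 (pR x) + Cnorm2 (pL x)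
  end.

Definition bII (cRR cLR cRL cLL : Cx) (gamma : R) : Cx :=
  Cmul (Cmul (Cconj cLR) (detU cRR cLR cRL cLL)) (Cexpi (- gamma)).

Definition rho (b : Cx) : R := sqrt (1 - Cnorm2 b).

Definition nuII (b : Cx) : R := rho b / Cmod (Cadd C1 b).

Definition Mb (b : Cx) : R :=
  let s := Cnorm2 b + Cre b in
  (1 + sgn s) * Cmod (Cdiv (RtoC s) (Cmul (Cadd C1 b) (Cadd C1 b))).

Definition limII (b : Cx) (t x : nat) : R :=
  (1 + (-1) ^ (x + t)) / 2 *
  match x with
  | O => (Rabs (Mb b)) ^ 2
  | S _ => (Rabs (Mb b)) ^ 2 * (1 + / (nuII b ^ 2)) * nuII b ^ (2 * x)
  end.

(* Main.v *)
From Stdlib Require Import Reals Lra Lia FunctionalExtensionality.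
Require Import Defs.
(* Imported last: unqualified complex operations are Coquelicot's, to which those of [Defs]
   other than [Cmod], [Cinv] and [Cdiv] are convertible. *)
From Coquelicot Require Import Rcomplements Rbar Hierarchy Continuity Lim_seq Series Complex.
Open Scope R_scope.

(** Let [L_x], [R_x] be the generating functions in time of the amplitudes at site [x]. The
    Wronskian [R_(x+1) L_(x+1) - R_(x+2) (L_x - L_x(0))] is geometric in [x], and finite
    propagation speed makes its low-order coefficients vanish for large [x], so it is zero; at
    [x = 0] this is a quadratic equation for [L_0].

    Write [1 + b = n v] with [n > 0] and [|v| = 1]. In the variable [X = Delta z^2 / v^2], and up
    to the phase of the initial state, the equation has leading coefficient [n (1 - X)] and
    discriminant [v^(-2) (1 - w v^2 X) (1 - w^(-1) v^2 X)] with [|w| = 1]. The coefficients of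
    [sqrt (1 - X)] are [1] followed by negative numbers adding up to [-1]: the root of the
    discriminant is therefore absolutely summable, which leaves the pole [X = 1] to govern the
    return amplitudes, and each of its two factors takes values in the sector [|Im| <= Re],
    which selects the value [2 |n - Re v|] of the root at the pole. The resulting limit is
    [(|n - Re v| + (n - Re v)) / n], where [n (n - Re v) = |b|^2 + Re b]. The step relations of
    the walk then carry the asymptotics from the origin to every site. *)

(** * Complex numbers *)

Lemma Cmult_eq_reg_l (c z w : C) : c <> 0 -> (c * z = c * w)%C -> z = w.
Proof.
  intros Hc H; transitivity (/ c * (c * z))%C; [now field|rewrite H; now field].
Qed.

Lemma RtoC_neq_0 (x : R) : x <> 0%R -> RtoC x <> 0.
Proof. intros Hx E; exact (Hx (RtoC_inj _ _ E)). Qed.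

Lemma Cmod_pow_le_1 (z : C) (n : nat) : Cmod z <= 1 -> Cmod (z ^ n) <= 1.
Proof.
  intro Hz; rewrite Cmod_pow, <- (pow1 n).
  apply pow_incr; split; [apply Cmod_ge_0|exact Hz].
Qed.

Lemma Re_le_Cmod (z : C) : Re z <= Cmod z.
Proof. exact (Rle_trans _ _ _ (Rle_abs _) (re_le_Cmod z)). Qed.

Lemma Cconj_RtoC (x : R) : Cconj x = x.
Proof. unfold Cconj; simpl; now rewrite Ropp_0. Qed.

Lemma Cmod_1_neq_0 (v : C) : Cmod v = 1 -> v <> 0.
Proof. intro Hv; apply Cmod_gt_0; lra. Qed.

Lemma Cconj_unit (v : C) : Cmod v = 1 -> (Cconj v = / v)%C.
Proof.
  intro Hv; apply (Cmult_eq_reg_l v); [now apply Cmod_1_neq_0|].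
  rewrite <- Cmod2_conj, Hv, pow1; field; now apply Cmod_1_neq_0.
Qed.

Lemma unit_Re (v : C) : Cmod v = 1 -> (2 * Re v = v + / v)%C.
Proof.
  intro Hv; rewrite re_alt, Cconj_unit by exact Hv; field; now apply Cmod_1_neq_0.
Qed.

Lemma Cmod_1_Re (c : R) : -1 <= c <= 1 -> exists w : C, Cmod w = 1 /\ Re w = c.
Proof.
  intro Hc; exists (c, sqrt (1 - c ^ 2)); split; [|reflexivity].
  change (sqrt (c ^ 2 + sqrt (1 - c ^ 2) ^ 2) = 1); rewrite pow2_sqrt by nra.
  rewrite <- sqrt_1 at 2; f_equal; ring.
Qed.

Lemma square_root_unique_Re (t : R) (v s : C) :
  0 <= t -> 0 < Re v -> 0 <= Re s -> (s * s = (t * v) * (t * v))%C -> s = (t * v)%C.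
Proof.
  intros Ht Hv Hs Hsqr.
  destruct (Ceq_dec (s - t * v) 0) as [Es|Hneq].
  - transitivity (s - t * v + t * v)%C; [ring|rewrite Es; ring].
  - assert (Es : (s + t * v = 0)%C).
    { apply (Cmult_eq_reg_l (s - t * v)); [exact Hneq|].
      transitivity (s * s - (t * v) * (t * v))%C; [ring|rewrite Hsqr; ring]. }
    assert (Et : t = 0).
    { apply (f_equal Re) in Es; rewrite re_plus, re_scal_l, re_RtoC in Es; nra. }
    subst t; transitivity (s + 0 * v)%C; [ring|rewrite Es; ring].
Qed.

Definition unit_dir (z : C) : C := ((/ Cmod z)%R * z)%C.

Lemma unit_dir_polar (z : C) : z <> 0 -> z = (Cmod z * unit_dir z)%C.
Proof.
  intro Hz; unfold unit_dir; assert (Cmod z <> 0%R) by (apply Cmod_gt_0 in Hz; lra).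
  rewrite Cmult_assoc, <- RtoC_mult, Rinv_r by assumption; ring.
Qed.

Lemma Cmod_unit_dir (z : C) : z <> 0 -> Cmod (unit_dir z) = 1.
Proof.
  intro Hz; apply Cmod_gt_0 in Hz; unfold unit_dir.
  rewrite Cmod_mult, Cmod_R, Rabs_pos_eq by (left; now apply Rinv_0_lt_compat); field; lra.
Qed.

(** * Asymptotics of complex sequences *)

Definition vanishes (f : nat -> C) : Prop := is_lim_seq (fun t => Cmod (f t)) 0.

Lemma vanishes_le (f : nat -> C) (e : nat -> R) :
  (forall t, Cmod (f t) <= e t) -> is_lim_seq e 0 -> vanishes f.
Proof.
  intros H He; apply (is_lim_seq_le_le (fun _ => 0) _ e); [|apply is_lim_seq_const|exact He].
  intro t; split; [apply Cmod_ge_0|apply H].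
Qed.

Lemma vanishes_ext (f g : nat -> C) : (forall t, f t = g t) -> vanishes f -> vanishes g.
Proof. intros H; apply is_lim_seq_ext; intro t; now rewrite H. Qed.

Lemma vanishes_mul_l (c : C) (f : nat -> C) : vanishes f -> vanishes (fun t => c * f t)%C.
Proof.
  intro H; apply (vanishes_le _ (fun t => Cmod c * Cmod (f t))).
  - intro t; rewrite Cmod_mult; lra.
  - rewrite <- (Rmult_0_r (Cmod c)); now apply (is_lim_seq_scal_l _ (Cmod c) 0).
Qed.

Lemma vanishes_plus (f g : nat -> C) :
  vanishes f -> vanishes g -> vanishes (fun t => f t + g t)%C.
Proof.
  intros Hf Hg; apply (vanishes_le _ (fun t => Cmod (f t) + Cmod (g t))).
  - intro t; apply Cmod_triangle.
  - rewrite <- (Rplus_0_r 0); now apply is_lim_seq_plus'.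
Qed.

Lemma is_lim_seq_div2 (e : nat -> R) (l : R) :
  is_lim_seq e l -> is_lim_seq (fun t => e (Nat.div2 t)) l.
Proof.
  intro H; apply (is_lim_seq_subseq e l Nat.div2); [|exact H].
  intros P [N HN]; exists (2 * N)%nat; intros n Hn; apply HN.
  rewrite <- (Nat.div2_double N); now apply Nat.div2_le_mono.
Qed.

Lemma vanishes_even (f : nat -> C) :
  (forall k, f (S (2 * k)) = 0) -> vanishes (fun k => f (2 * k)%nat) -> vanishes f.
Proof.
  intros Hodd Heven; apply (vanishes_le _ (fun t => Cmod (f (2 * Nat.div2 t)%nat))).
  - intro t; rewrite (Nat.div2_odd t) at 1; destruct (Nat.odd t); simpl Nat.b2n.
    + rewrite Nat.add_1_r, Hodd, Cmod_0; apply Cmod_ge_0.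
    + rewrite Nat.add_0_r; apply Rle_refl.
  - exact (is_lim_seq_div2 _ _ Heven).
Qed.

Definition even_geom (w mu : C) : nat -> C :=
  fun t => if Nat.even t then (w * mu ^ Nat.div2 t)%C else 0.

Lemma even_geom_double (w mu : C) (k : nat) : even_geom w mu (2 * k) = (w * mu ^ k)%C.
Proof. unfold even_geom; now rewrite Nat.even_even, Nat.div2_double. Qed.

Lemma even_geom_odd (w mu : C) (k : nat) : even_geom w mu (S (2 * k)) = 0.
Proof. unfold even_geom; now rewrite <- Nat.add_1_r, Nat.even_odd. Qed.

Lemma even_geom_SS (w mu : C) (t : nat) :
  even_geom w mu (S (S t)) = (mu * even_geom w mu t)%C.
Proof. unfold even_geom; simpl; destruct (Nat.even t); ring. Qed.

Lemma Cmod_even_geom_sqr (w mu : C) (t : nat) :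
  Cmod mu = 1 -> Cmod (even_geom w mu t) ^ 2 = (1 + (-1) ^ t) / 2 * Cmod w ^ 2.
Proof.
  intro Hmu; destruct (Nat.Even_or_Odd t) as [[k ->]|[k ->]].
  - rewrite even_geom_double, Cmod_mult, Cmod_pow, Hmu, pow1, pow_1_even; field.
  - rewrite Nat.add_1_r, even_geom_odd, Cmod_0, pow_1_odd; field.
Qed.

Lemma Cmod_even_geom_le (w mu : C) (t : nat) :
  Cmod mu = 1 -> Cmod (even_geom w mu t) <= Cmod w.
Proof.
  intro Hmu; unfold even_geom; destruct (Nat.even t).
  - rewrite Cmod_mult, Cmod_pow, Hmu, pow1, Rmult_1_r; apply Rle_refl.
  - rewrite Cmod_0; apply Cmod_ge_0.
Qed.

Lemma Cmod_sqr_asymptotic (f g : nat -> C) (K : R) :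
  vanishes (fun t => f t - g t)%C -> (forall t, Cmod (g t) <= K) ->
  is_lim_seq (fun t => Cmod (f t) ^ 2 - Cmod (g t) ^ 2) 0.
Proof.
  intros H HK; apply is_lim_seq_abs_0.
  set (e := fun t => Cmod (f t - g t)).
  apply (is_lim_seq_le_le (fun _ => 0) _ (fun t => e t * (e t + 2 * K)));
    [|apply is_lim_seq_const|].
  - intro t; split; [apply Rabs_pos|specialize (HK t)].
    assert (Hfg : Rabs (Cmod (f t) - Cmod (g t)) <= e t)
      by exact (norm_triangle_inv (V := C_NormedModule) (f t) (g t)).
    replace (Cmod (f t) ^ 2 - Cmod (g t) ^ 2)
      with ((Cmod (f t) - Cmod (g t)) * (Cmod (f t) + Cmod (g t))) by ring.
    rewrite Rabs_mult; pose proof (Cmod_ge_0 (f t)); pose proof (Cmod_ge_0 (g t)).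
    rewrite (Rabs_pos_eq (_ + _)) by lra.
    apply Rmult_le_compat; [apply Rabs_pos|lra|exact Hfg|].
    apply Rabs_le_between in Hfg; lra.
  - replace 0 with (0 * (0 + 2 * K)) by ring.
    apply is_lim_seq_mult'; [exact H|apply is_lim_seq_plus'; [exact H|apply is_lim_seq_const]].
Qed.

(** * Formal power series *)

Definition ps : Type := nat -> C.

Definition ps_const (c : C) : ps := fun n => match n with O => c | S _ => 0 end.
Definition ps_X : ps := fun n => match n with 1%nat => 1 | _ => 0 end.
Definition ps_add (a b : ps) : ps := fun n => (a n + b n)%C.
Definition ps_opp (a : ps) : ps := fun n => (- a n)%C.
Definition ps_sub (a b : ps) : ps := fun n => (a n - b n)%C.
Definition ps_tail (a : ps) : ps := fun n => a (S n).

(* Cauchy product, through [a b = a_0 b + X (tail a) b]. *)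
Fixpoint ps_mul_coef (n : nat) (a b : ps) : C :=
  match n with
  | O => (a O * b O)%C
  | S m => (a O * b n + ps_mul_coef m (ps_tail a) b)%C
  end.

Definition ps_mul (a b : ps) : ps := fun n => ps_mul_coef n a b.

Declare Scope ps_scope.
Delimit Scope ps_scope with ps.
Bind Scope ps_scope with ps.
Notation "a + b" := (ps_add a b) : ps_scope.
Notation "a - b" := (ps_sub a b) : ps_scope.
Notation "a * b" := (ps_mul a b) : ps_scope.
Notation "# c" := (ps_const c%C) (at level 5, c at level 5, format "# c") : ps_scope.

Lemma ps_ext (a b : ps) : (forall n, a n = b n) -> a = b.
Proof. apply functional_extensionality. Qed.

Lemma ps_mul_0 (a b : ps) : ps_mul a b O = (a O * b O)%C.
Proof. reflexivity. Qed.

Lemma ps_mul_S (a b : ps) (n : nat) :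
  ps_mul a b (S n) = (a O * b (S n) + ps_mul (ps_tail a) b n)%C.
Proof. reflexivity. Qed.

Lemma ps_tail_mul (a b : ps) :
  ps_tail (a * b)%ps = (ps_add (fun n => a O * ps_tail b n)%C (ps_tail a * b)%ps).
Proof. reflexivity. Qed.

Lemma ps_mul_add_l (a b c : ps) : ((a + b) * c = a * c + b * c)%ps.
Proof.
  apply ps_ext; intro n; unfold ps_add at 2; revert a b.
  induction n as [|n IH]; intros a b; [unfold ps_mul, ps_add; simpl; ring|].
  rewrite !ps_mul_S; change (ps_tail (a + b)%ps) with (ps_tail a + ps_tail b)%ps.
  rewrite IH; unfold ps_add; ring.
Qed.

Lemma ps_mul_scal_l (k : C) (a b : ps) (n : nat) :
  ps_mul (fun i => k * a i)%C b n = (k * ps_mul a b n)%C.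
Proof.
  revert a; induction n as [|n IH]; intro a; [unfold ps_mul; simpl; ring|].
  rewrite !ps_mul_S.
  change (ps_tail (fun i => k * a i)%C) with (fun i => k * ps_tail a i)%C.
  rewrite IH; ring.
Qed.

Lemma ps_mul_low_order (a b : ps) (n : nat) :
  (forall k, (k <= n)%nat -> a k = 0) -> ps_mul a b n = 0.
Proof.
  revert a; induction n as [|n IH]; intros a Ha.
  - rewrite ps_mul_0, Ha by lia; ring.
  - rewrite ps_mul_S, Ha, IH by (lia || (intros k Hk; apply Ha; lia)); ring.
Qed.

Lemma ps_mul_comm (a b : ps) : (a * b = b * a)%ps.
Proof.
  apply ps_ext; intro n; revert a b.
  induction n as [n IH] using (well_founded_induction Wf_nat.lt_wf); intros a b.
  destruct n as [|n]; [unfold ps_mul; simpl; ring|].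
  rewrite !ps_mul_S, (IH n ltac:(lia) (ps_tail a) b), (IH n ltac:(lia) (ps_tail b) a).
  destruct n as [|n]; [unfold ps_mul, ps_tail; simpl; ring|].
  rewrite !ps_mul_S, (IH n ltac:(lia) (ps_tail a) (ps_tail b)); unfold ps_tail; ring.
Qed.

Lemma ps_mul_assoc (a b c : ps) : (a * (b * c) = a * b * c)%ps.
Proof.
  apply ps_ext; intro n; revert a b.
  induction n as [|n IH]; intros a b; [unfold ps_mul; simpl; ring|].
  rewrite (ps_mul_S a), (ps_mul_S (ps_mul a b)), IH, ps_tail_mul, ps_mul_add_l.
  unfold ps_add; rewrite ps_mul_scal_l, ps_mul_S, ps_mul_0; ring.
Qed.

Lemma ps_const_mul (k : C) (a : ps) (n : nat) : ps_mul (ps_const k) a n = (k * a n)%C.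
Proof.
  destruct n as [|n]; [reflexivity|].
  rewrite ps_mul_S, ps_mul_low_order by reflexivity; simpl; ring.
Qed.

Lemma ps_X_mul_0 (a : ps) : ps_mul ps_X a O = 0.
Proof. rewrite ps_mul_0; simpl; ring. Qed.

Lemma ps_X_mul_S (a : ps) (n : nat) : ps_mul ps_X a (S n) = a n.
Proof.
  rewrite ps_mul_S.
  replace (ps_tail ps_X) with (ps_const 1) by (apply ps_ext; now intros [|k]).
  rewrite ps_const_mul; simpl; ring.
Qed.

Lemma ps_const_plus (c d : C) : (#(c + d) = #c + #d)%ps.
Proof. apply ps_ext; intros [|n]; unfold ps_add; simpl; ring. Qed.

Lemma ps_const_minus (c d : C) : (#(c - d) = #c - #d)%ps.
Proof. apply ps_ext; intros [|n]; unfold ps_sub; simpl; ring. Qed.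

Lemma ps_const_opp (c : C) : (#(- c) = ps_opp #c)%ps.
Proof. apply ps_ext; intros [|n]; unfold ps_opp; simpl; ring. Qed.

Lemma ps_const_mult (c d : C) : (#(c * d) = #c * #d)%ps.
Proof. apply ps_ext; intro n; rewrite ps_const_mul; destruct n; simpl; ring. Qed.

Lemma ps_ring_theory :
  ring_theory (ps_const 0) (ps_const 1) ps_add ps_mul ps_sub ps_opp (@eq ps).
Proof.
  split; intros; [| | | |exact (ps_mul_comm _ _)|exact (ps_mul_assoc _ _ _)
                 |exact (ps_mul_add_l _ _ _)| |];
    apply ps_ext; intro n; rewrite ?ps_const_mul; unfold ps_add, ps_sub, ps_opp;
    destruct n; simpl; ring.
Qed.

Lemma ps_ring_morph :
  ring_morph (ps_const 0) (ps_const 1) ps_add ps_mul ps_sub ps_opp (@eq ps)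
    0%Z 1%Z Z.add Z.mul Z.sub Z.opp Z.eqb (fun z => #(IZR z))%ps.
Proof.
  split; [| | | | | |now intros x y ->%Z.eqb_eq];
    intros; rewrite ?plus_IZR, ?minus_IZR, ?mult_IZR, ?opp_IZR;
    rewrite ?RtoC_plus, ?RtoC_minus, ?RtoC_mult, ?RtoC_opp;
    auto using ps_const_plus, ps_const_minus, ps_const_mult, ps_const_opp.
Qed.

Ltac ps_numeral t :=
  lazymatch t with
  | ps_const (RtoC (IZR ?z)) => match isZcst z with true => z | _ => constr:(NotConstant) end
  | _ => constr:(NotConstant)
  end.

Add Ring ps_ring : ps_ring_theory (morphism ps_ring_morph, constants [ps_numeral]).

Lemma ps_X_mul_cancel (a b : ps) : (ps_X * a = ps_X * b)%ps -> a = b.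
Proof. intro H; apply ps_ext; intro n; now rewrite <- (ps_X_mul_S a), H, ps_X_mul_S. Qed.

Lemma ps_mul_eq_0 (a b : ps) : (a * b = #0)%ps -> b O <> 0 -> (a = #0)%ps.
Proof.
  intros H Hb; apply ps_ext; intro n; transitivity (RtoC 0); [|now destruct n].
  revert a H; induction n as [|n IH]; intros a H.
  all: assert (Ha : a O = 0)
         by (destruct (Ceq_dec (a O) 0) as [|Ha]; [assumption|];
             now destruct (Cmult_neq_0 _ _ Ha Hb); rewrite <- ps_mul_0, H).
  - exact Ha.
  - apply (IH (ps_tail a)), ps_ext; intro k.
    transitivity (ps_mul a b (S k)); [|now rewrite H; destruct k].
    rewrite ps_mul_S, Ha; ring.
Qed.

Lemma ps_mul_cancel_l (a b c : ps) : a O <> 0 -> (a * b = a * c)%ps -> b = c.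
Proof.
  intros Ha H.
  assert (Ediff : (b - c = #0)%ps).
  { apply (ps_mul_eq_0 _ a); [|exact Ha].
    transitivity (a * b - a * c)%ps; [ring|rewrite H; ring]. }
  transitivity (b - c + c)%ps; [ring|rewrite Ediff; ring].
Qed.

Lemma ps_square_inj (a b : ps) : (a * a = b * b)%ps -> a O = b O -> a O <> 0 -> a = b.
Proof.
  intros Hsqr Hconst Ha; apply (ps_mul_cancel_l (a + b)%ps).
  - unfold ps_add; rewrite <- Hconst; intro Edouble; apply Ha.
    transitivity ((a O + a O) / 2)%C; [|rewrite Edouble]; field; apply RtoC_neq_0; lra.
  - transitivity (a * a + a * b)%ps; [ring|rewrite Hsqr; ring].
Qed.

Definition ps_dilate (y : C) (a : ps) : ps := fun n => (y ^ n * a n)%C.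

Lemma ps_dilate_add (y : C) (a b : ps) :
  ps_dilate y (a + b)%ps = (ps_dilate y a + ps_dilate y b)%ps.
Proof. apply ps_ext; intro n; unfold ps_dilate, ps_add; ring. Qed.

Lemma ps_dilate_sub (y : C) (a b : ps) :
  ps_dilate y (a - b)%ps = (ps_dilate y a - ps_dilate y b)%ps.
Proof. apply ps_ext; intro n; unfold ps_dilate, ps_sub; ring. Qed.

Lemma ps_dilate_const (y c : C) : ps_dilate y (ps_const c) = ps_const c.
Proof. apply ps_ext; intros [|n]; unfold ps_dilate; simpl; ring. Qed.

Lemma ps_dilate_X (y : C) : (ps_dilate y ps_X = #y * ps_X)%ps.
Proof.
  apply ps_ext; intros [|[|n]]; unfold ps_dilate; rewrite ps_const_mul; simpl; ring.
Qed.

Lemma ps_dilate_mul (y : C) (a b : ps) :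
  ps_dilate y (a * b)%ps = (ps_dilate y a * ps_dilate y b)%ps.
Proof.
  apply ps_ext; intro n; unfold ps_dilate at 1; revert a.
  induction n as [|n IH]; intro a; [unfold ps_mul, ps_dilate; simpl; ring|].
  rewrite !ps_mul_S.
  replace (ps_tail (ps_dilate y a)) with (fun i => y * ps_dilate y (ps_tail a) i)%C
    by (apply ps_ext; intro i; unfold ps_dilate, ps_tail; simpl; ring).
  rewrite ps_mul_scal_l, <- IH; unfold ps_dilate; simpl; ring.
Qed.

Definition ps_even_part (a : ps) : ps := fun n => a (2 * n)%nat.

Lemma ps_even_part_const (c : C) : ps_even_part (ps_const c) = ps_const c.
Proof. apply ps_ext; now intros [|n]. Qed.

Lemma ps_even_part_X2_mul (a : ps) :
  (ps_even_part (ps_X * (ps_X * a)) = ps_X * ps_even_part a)%ps.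
Proof.
  apply ps_ext; intros [|n]; unfold ps_even_part.
  - simpl Nat.mul; now rewrite !ps_X_mul_0.
  - replace (2 * S n)%nat with (S (S (2 * n))) by lia; now rewrite !ps_X_mul_S.
Qed.

Lemma ps_even_part_mul (a b : ps) :
  (forall n, a (S (2 * n)) = 0) ->
  (ps_even_part (a * b) = ps_even_part a * ps_even_part b)%ps.
Proof.
  intro Ha; apply ps_ext; intro n; unfold ps_even_part at 1.
  revert a Ha; induction n as [|n IH]; intros a Ha; [reflexivity|].
  replace (2 * S n)%nat with (S (S (2 * n))) by lia.
  rewrite !ps_mul_S, IH.
  - replace (ps_even_part (ps_tail (ps_tail a))) with (ps_tail (ps_even_part a)).
    + change (ps_tail a O) with (a (S (2 * 0))); rewrite Ha.
      unfold ps_even_part at 3 4; replace (2 * S n)%nat with (S (S (2 * n))) by lia.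
      simpl Nat.mul; ring.
    + apply ps_ext; intro k; unfold ps_even_part, ps_tail; f_equal; lia.
  - intro k; unfold ps_tail; replace (S (S (S (2 * k)))) with (S (2 * S k)) by lia; apply Ha.
Qed.

Lemma ps_even_part_quadratic (a : ps) (p q r p' q' : C) :
  (forall n, a (S (2 * n)) = 0) ->
  (#p * (a * a) - #q * a + #r - ps_X * (ps_X * (#p' * (a * a) - #q' * a)) = #0)%ps ->
  let e := ps_even_part a in
  (#p * (e * e) - #q * e + #r - ps_X * (#p' * (e * e) - #q' * e) = #0)%ps.
Proof.
  intros Ha H e; apply (f_equal ps_even_part) in H; rewrite ps_even_part_const in H.
  assert (Hscal : forall c b, ps_even_part (#c * b)%ps = (#c * ps_even_part b)%ps).
  { intros c b; rewrite ps_even_part_mul, ps_even_part_const; trivial. }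
  rewrite <- H.
  transitivity (ps_even_part (#p * (a * a)) - ps_even_part (#q * a) + ps_even_part #r
    - ps_even_part (ps_X * (ps_X * (#p' * (a * a) - #q' * a))))%ps; [|reflexivity].
  rewrite ps_even_part_X2_mul.
  change (ps_even_part (#p' * (a * a) - #q' * a)%ps)
    with (ps_even_part (#p' * (a * a))%ps - ps_even_part (#q' * a)%ps)%ps.
  now rewrite !Hscal, ps_even_part_const, ps_even_part_mul.
Qed.

Definition ps_theta (a : ps) : ps := fun n => (INR n * a n)%C.

Lemma ps_theta_mul (a b : ps) :
  (ps_theta (a * b) = ps_theta a * b + a * ps_theta b)%ps.
Proof.
  apply ps_ext; intro n; unfold ps_theta at 1, ps_add; revert a.
  induction n as [|n IH]; intro a; [unfold ps_mul, ps_theta; simpl; ring|].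
  rewrite !ps_mul_S.
  replace (ps_tail (ps_theta a)) with (ps_theta (ps_tail a) + ps_tail a)%ps.
  - rewrite ps_mul_add_l; unfold ps_add.
    transitivity (INR (S n) * (a O * b (S n)) + INR n * ps_mul (ps_tail a) b n
                  + ps_mul (ps_tail a) b n)%C; [rewrite S_INR, RtoC_plus; ring|].
    rewrite IH; unfold ps_theta; simpl (INR 0); ring.
  - apply ps_ext; intro k; unfold ps_add, ps_theta, ps_tail.
    rewrite S_INR, RtoC_plus; ring.
Qed.

(** * Sums of power series *)

Definition ps_sums (a : ps) (l : C) : Prop := @is_series C_AbsRing C_NormedModule a l.
Definition ps_abs_summable (a : ps) : Prop := ex_series (fun n => Cmod (a n)).

Lemma ps_abs_summable_sums (a : ps) : ps_abs_summable a -> exists l, ps_sums a l.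
Proof.
  apply (@ex_series_le C_AbsRing C_CompleteNormedModule a).
  intro n; apply Rle_refl.
Qed.

Lemma sum_n_Re (a : ps) (n : nat) :
  Re (@sum_n C_AbelianMonoid a n) = sum_n (fun k => Re (a k)) n.
Proof. induction n as [|n IH]; [now rewrite !sum_O|]. now rewrite !sum_Sn, <- IH. Qed.

Lemma sum_n_Im (a : ps) (n : nat) :
  Im (@sum_n C_AbelianMonoid a n) = sum_n (fun k => Im (a k)) n.
Proof. induction n as [|n IH]; [now rewrite !sum_O|]. now rewrite !sum_Sn, <- IH. Qed.

Lemma ps_sums_Re_Im (a : ps) (l : C) :
  ps_sums a l <-> is_series (fun n => Re (a n)) (Re l) /\ is_series (fun n => Im (a n)) (Im l).
Proof.
  split.
  - intro H; split.
    + apply (filterlim_ext _ _ (sum_n_Re a)), (filterlim_comp _ _ _ _ _ _ _ _ H).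
      apply (continuous_fst (U := R_UniformSpace) (V := R_UniformSpace)).
    + apply (filterlim_ext _ _ (sum_n_Im a)), (filterlim_comp _ _ _ _ _ _ _ _ H).
      apply (continuous_snd (U := R_UniformSpace) (V := R_UniformSpace)).
  - intros [HRe HIm]; apply (filterlim_locally (U := C_UniformSpace)); intro eps.
    generalize (filter_and _ _ (proj1 (filterlim_locally _ _) HRe eps)
                               (proj1 (filterlim_locally _ _) HIm eps)).
    apply filter_imp; intros n [BRe BIm].
    rewrite <- sum_n_Re in BRe; rewrite <- sum_n_Im in BIm; now split.
Qed.

Lemma ps_sums_sub (a b : ps) (la lb : C) :
  ps_sums a la -> ps_sums b lb -> ps_sums (a - b)%ps (la - lb)%C.
Proof. apply (@is_series_minus C_AbsRing C_NormedModule). Qed.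

Lemma ps_sums_const_mul (c : C) (a : ps) (l : C) :
  ps_sums a l -> ps_sums (#c * a)%ps (c * l)%C.
Proof.
  intro H; apply (is_series_ext (V := C_NormedModule) (fun n => c * a n)%C).
  - intro n; symmetry; apply ps_const_mul.
  - exact (is_series_scal (V := C_NormedModule) c a l H).
Qed.

Lemma ps_sums_const (c : C) : ps_sums (ps_const c) c.
Proof.
  apply (filterlim_ext (fun _ => c)); [|apply filterlim_const].
  intro n; induction n as [|n IH]; [now rewrite sum_O|].
  rewrite sum_Sn, <- IH; symmetry; apply (plus_zero_r (G := C_AbelianMonoid)).
Qed.

Lemma ps_sums_X_mul (a : ps) (l : C) : ps_sums a l -> ps_sums (ps_X * a)%ps l.
Proof.
  intro H; apply (is_series_decr_1 (V := C_NormedModule)).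
  rewrite ps_X_mul_0; replace (plus _ _) with l by (change (l = l + - 0)%C; ring).
  apply (is_series_ext a); [intro n; symmetry; apply ps_X_mul_S|exact H].
Qed.

Lemma ps_sums_X : ps_sums ps_X 1.
Proof.
  replace ps_X with (ps_X * #1)%ps by ring; apply ps_sums_X_mul, ps_sums_const.
Qed.

Lemma ps_mul_Re_Im (a b : ps) (n : nat) :
  Re (ps_mul a b n) =
    (sum_f_R0 (fun k => Re (a k) * Re (b (n - k)%nat)) n -
     sum_f_R0 (fun k => Im (a k) * Im (b (n - k)%nat)) n)%R /\
  Im (ps_mul a b n) =
    (sum_f_R0 (fun k => Re (a k) * Im (b (n - k)%nat)) n +
     sum_f_R0 (fun k => Im (a k) * Re (b (n - k)%nat)) n)%R.
Proof.
  revert a; induction n as [|n IH]; intro a; [now rewrite ps_mul_0|].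
  destruct (IH (ps_tail a)) as [ERe EIm].
  rewrite ps_mul_S, re_plus, im_plus, re_mult, im_mult, ERe, EIm.
  rewrite !(decomp_sum _ (S n)) by lia; simpl; unfold ps_tail; split; ring.
Qed.

Lemma ps_abs_summable_Re_Im (a : ps) :
  ps_abs_summable a ->
  ex_series (fun n => Rabs (Re (a n))) /\ ex_series (fun n => Rabs (Im (a n))).
Proof.
  intro Ha; split; apply (ex_series_le (V := R_CompleteNormedModule)) with (2 := Ha); intro n;
    (eapply Rle_trans; [apply Req_le, Rabs_Rabsolu|]).
  - apply re_le_Cmod.
  - exact (Rle_trans _ _ _ (Rmax_r _ _) (Rmax_Cmod _)).
Qed.

Lemma ps_sums_mul (a b : ps) (la lb : C) :
  ps_abs_summable a -> ps_abs_summable b ->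
  ps_sums a la -> ps_sums b lb -> ps_sums (a * b)%ps (la * lb)%C.
Proof.
  intros [HaR HaI]%ps_abs_summable_Re_Im [HbR HbI]%ps_abs_summable_Re_Im.
  intros [SaR SaI]%ps_sums_Re_Im [SbR SbI]%ps_sums_Re_Im.
  apply ps_sums_Re_Im; rewrite re_mult, im_mult; split.
  - eapply is_series_ext; [intro n; symmetry; apply (ps_mul_Re_Im a b n)|].
    apply (is_series_minus (V := R_NormedModule));
      [apply (is_series_mult _ _ _ _ SaR SbR)|apply (is_series_mult _ _ _ _ SaI SbI)];
      assumption.
  - eapply is_series_ext; [intro n; symmetry; apply (ps_mul_Re_Im a b n)|].
    apply (is_series_plus (V := R_NormedModule));
      [apply (is_series_mult _ _ _ _ SaR SbI)|apply (is_series_mult _ _ _ _ SaI SbR)];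
      assumption.
Qed.

Lemma ps_abs_summable_dilate (y : C) (a : ps) :
  Cmod y <= 1 -> ps_abs_summable a -> ps_abs_summable (ps_dilate y a).
Proof.
  intros Hy; apply (ex_series_le (V := R_CompleteNormedModule)).
  intro n; eapply Rle_trans; [apply Req_le, Rabs_pos_eq, Cmod_ge_0|].
  unfold ps_dilate; rewrite Cmod_mult.
  pose proof (Cmod_pow_le_1 y n Hy); pose proof (Cmod_ge_0 (a n)); nra.
Qed.

Lemma ps_sums_mul_one_minus_X (a : ps) (l : C) :
  ps_sums ((#1 - ps_X) * a)%ps l -> vanishes (fun n => a n - l)%C.
Proof.
  intro H; apply is_lim_seq_spec; intro eps.
  apply (filterlim_locally_ball_norm (U := C_NormedModule)) with (eps := eps) in H.
  revert H; apply filter_imp; intro n.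
  replace (sum_n _ n) with (a n).
  - now rewrite Rminus_0_r, (Rabs_pos_eq (Cmod _)) by apply Cmod_ge_0.
  - replace ((#1 - ps_X) * a)%ps with (a - ps_X * a)%ps by ring; unfold ps_sub.
    induction n as [|n IH].
    + rewrite sum_O, ps_X_mul_0; ring.
    + rewrite sum_Sn, <- IH, ps_X_mul_S; change (a (S n) = a n + (a (S n) - a n))%C; ring.
Qed.

(** * The binomial series of [sqrt (1 - X)] *)

(* [C(2 n, n) / 4^n], the coefficients of [(1 - X)^(-1/2)]. *)
Fixpoint inv_sqrt_coef (n : nat) : R :=
  match n with
  | O => 1
  | S m => inv_sqrt_coef m * ((2 * INR m + 1) / (2 * INR m + 2))
  end.

Lemma inv_sqrt_coef_pos (n : nat) : 0 < inv_sqrt_coef n.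
Proof.
  induction n as [|n IH]; simpl; [lra|].
  pose proof (pos_INR n); apply Rmult_lt_0_compat, Rdiv_lt_0_compat; lra.
Qed.

Lemma inv_sqrt_coef_decr (n : nat) : inv_sqrt_coef (S n) <= inv_sqrt_coef n.
Proof.
  pose proof (inv_sqrt_coef_pos n); pose proof (pos_INR n); simpl.
  rewrite <- (Rmult_1_r (inv_sqrt_coef n)) at 2; apply Rmult_le_compat_l; [lra|].
  apply Rle_div_l; lra.
Qed.

Definition inv_sqrt_series : ps := fun n => inv_sqrt_coef n.
Definition sqrt_series : ps := ((#1 - ps_X) * inv_sqrt_series)%ps.

Lemma ps_theta_inv_sqrt_series :
  (#2 * ps_theta inv_sqrt_series = ps_X * (#2 * ps_theta inv_sqrt_series + inv_sqrt_series))%ps.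
Proof.
  apply ps_ext; intros [|n]; rewrite ?ps_X_mul_0, ?ps_X_mul_S; unfold ps_add;
    rewrite ?ps_const_mul; unfold ps_theta, inv_sqrt_series.
  - simpl; ring.
  - rewrite <- !RtoC_mult, <- RtoC_plus; f_equal; rewrite S_INR; simpl.
    pose proof (pos_INR n); field; lra.
Qed.

Lemma inv_sqrt_series_square : ((#1 - ps_X) * (inv_sqrt_series * inv_sqrt_series) = #1)%ps.
Proof.
  set (c := (inv_sqrt_series * inv_sqrt_series)%ps).
  assert (Hode : (ps_theta c = ps_X * (ps_theta c + c))%ps).
  { unfold c; rewrite ps_theta_mul.
    transitivity (inv_sqrt_series * (#2 * ps_theta inv_sqrt_series))%ps; [ring|].
    rewrite ps_theta_inv_sqrt_series; ring. }
  assert (Hc : forall n, c (S n) = c n).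
  { intro n; apply (f_equal (fun a => a (S n))) in Hode; revert Hode.
    rewrite ps_X_mul_S; unfold ps_theta, ps_add; rewrite S_INR, RtoC_plus; intro Hode.
    assert (Hn : RtoC (INR n + 1) <> 0) by (apply RtoC_neq_0; pose proof (pos_INR n); lra).
    apply (Cmult_eq_reg_l (INR n + 1)%R); [exact Hn|rewrite RtoC_plus, Hode; ring]. }
  apply ps_ext; intro n.
  replace ((#1 - ps_X) * c)%ps with (c - ps_X * c)%ps by ring.
  unfold ps_sub; destruct n as [|n]; rewrite ?ps_X_mul_0, ?ps_X_mul_S, ?Hc; simpl; [|ring].
  unfold c; rewrite ps_mul_0; unfold inv_sqrt_series; simpl; ring.
Qed.

Lemma sqrt_series_square : (sqrt_series * sqrt_series = #1 - ps_X)%ps.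
Proof.
  unfold sqrt_series.
  transitivity ((#1 - ps_X) * ((#1 - ps_X) * (inv_sqrt_series * inv_sqrt_series)))%ps; [ring|].
  rewrite inv_sqrt_series_square; ring.
Qed.

Lemma sqrt_series_0 : sqrt_series O = 1.
Proof. unfold sqrt_series, ps_sub, inv_sqrt_series; rewrite ps_mul_0; simpl; ring. Qed.

Lemma sqrt_series_S (n : nat) : sqrt_series (S n) = (inv_sqrt_coef (S n) - inv_sqrt_coef n)%R.
Proof.
  unfold sqrt_series; replace ((#1 - ps_X) * inv_sqrt_series)%ps
    with (inv_sqrt_series - ps_X * inv_sqrt_series)%ps by ring.
  unfold ps_sub; now rewrite ps_X_mul_S, RtoC_minus.
Qed.

Lemma ps_abs_summable_sqrt_series : ps_abs_summable sqrt_series.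
Proof.
  apply (ex_finite_lim_seq_incr _ 2).
  - intro n; rewrite sum_Sn; pose proof (Cmod_ge_0 (sqrt_series (S n))); unfold plus; simpl; lra.
  - assert (Esum : forall n, sum_n (fun k => Cmod (sqrt_series k)) n = 2 - inv_sqrt_coef n).
    { induction n as [|n IH].
      - rewrite sum_O, sqrt_series_0, Cmod_1; simpl; ring.
      - pose proof (inv_sqrt_coef_decr n).
        rewrite sum_Sn, IH, sqrt_series_S, Cmod_R, Rabs_left1 by lra; unfold plus; simpl; ring. }
    intro n; rewrite Esum; pose proof (inv_sqrt_coef_pos n); lra.
Qed.

(* After the first coefficient [1], all are negative and their sum is at least [-1]. *)
Lemma sqrt_series_sum_Re (z s : C) :
  Cmod z <= 1 -> ps_sums (ps_dilate z sqrt_series) s -> 0 <= Re s.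
Proof.
  intros Hz [Hs _]%ps_sums_Re_Im.
  apply (is_lim_seq_le (fun _ => 0) (sum_n (fun n => Re (ps_dilate z sqrt_series n))) 0 (Re s));
    [|apply is_lim_seq_const|exact Hs].
  intro n; apply Rle_trans with (1 := Rlt_le _ _ (inv_sqrt_coef_pos n)).
  induction n as [|n IH].
  - rewrite sum_O; unfold ps_dilate; rewrite sqrt_series_0; simpl; lra.
  - rewrite sum_Sn.
    replace (inv_sqrt_coef (S n))
      with (inv_sqrt_coef n + (inv_sqrt_coef (S n) - inv_sqrt_coef n)) by ring.
    apply Rplus_le_compat; [exact IH|].
    unfold ps_dilate; rewrite sqrt_series_S, re_scal_r.
    pose proof (Rle_trans _ _ _ (Re_le_Cmod _) (Cmod_pow_le_1 z (S n) Hz)).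
    pose proof (inv_sqrt_coef_decr n); nra.
Qed.

Lemma sqrt_series_sum_square (z s : C) :
  Cmod z <= 1 -> ps_sums (ps_dilate z sqrt_series) s -> (s * s = 1 - z)%C.
Proof.
  intros Hz Hs.
  assert (Ha := ps_abs_summable_dilate z _ Hz ps_abs_summable_sqrt_series).
  apply (filterlim_locally_unique (V := C_NormedModule) (F := eventually))
    with (1 := ps_sums_mul _ _ _ _ Ha Ha Hs Hs).
  rewrite <- ps_dilate_mul, sqrt_series_square, ps_dilate_sub, ps_dilate_const, ps_dilate_X.
  replace (1 - z)%C with (1 - z * 1)%C by ring.
  apply ps_sums_sub, ps_sums_const_mul, ps_sums_X; apply ps_sums_const.
Qed.

Lemma sqrt_series_sum_sector (z s : C) :
  Cmod z <= 1 -> ps_sums (ps_dilate z sqrt_series) s -> Rabs (Im s) <= Re s.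
Proof.
  intros Hz Hs; apply Rsqr_incr_0_var; [|exact (sqrt_series_sum_Re z s Hz Hs)].
  rewrite <- Rsqr_abs; unfold Rsqr.
  assert (Hsqr := f_equal Re (sqrt_series_sum_square z s Hz Hs)); unfold Cminus in Hsqr.
  rewrite re_mult, re_plus, re_opp, re_RtoC in Hsqr.
  pose proof (Re_le_Cmod z); lra.
Qed.

Lemma sqrt_factored_quadratic (z w : C) (a : ps) :
  (a * a = (#1 - #z * ps_X) * (#1 - #w * ps_X))%ps -> a O = 1 ->
  (a = ps_dilate z sqrt_series * ps_dilate w sqrt_series)%ps.
Proof.
  intros Ha Ha0; apply ps_square_inj.
  - transitivity (ps_dilate z (sqrt_series * sqrt_series)
                  * ps_dilate w (sqrt_series * sqrt_series))%ps; [|rewrite !ps_dilate_mul; ring].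
    now rewrite sqrt_series_square, !ps_dilate_sub, !ps_dilate_const, !ps_dilate_X.
  - rewrite ps_mul_0, Ha0; unfold ps_dilate; rewrite sqrt_series_0; simpl; ring.
  - rewrite Ha0; exact C1_nz.
Qed.

(* The sums of both factors lie in the sector [|Im| <= Re], so that of the product has a
   nonnegative real part. *)
Lemma sqrt_factored_quadratic_sum (z w : C) (a : ps) :
  Cmod z <= 1 -> Cmod w <= 1 ->
  (a * a = (#1 - #z * ps_X) * (#1 - #w * ps_X))%ps -> a O = 1 ->
  exists s, ps_sums a s /\ (s * s = (1 - z) * (1 - w))%C /\ 0 <= Re s.
Proof.
  intros Hz Hw Ha Ha0; rewrite (sqrt_factored_quadratic z w a Ha Ha0).
  assert (Hsum := fun y Hy => ps_abs_summable_dilate y _ Hy ps_abs_summable_sqrt_series).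
  destruct (ps_abs_summable_sums _ (Hsum z Hz)) as [s Hs].
  destruct (ps_abs_summable_sums _ (Hsum w Hw)) as [t Ht].
  exists (s * t)%C; repeat split.
  - now apply ps_sums_mul; auto.
  - rewrite <- (sqrt_series_sum_square z s Hz Hs), <- (sqrt_series_sum_square w t Hw Ht); ring.
  - assert (Hs_sector := sqrt_series_sum_sector z s Hz Hs).
    assert (Ht_sector := sqrt_series_sum_sector w t Hw Ht).
    apply Rabs_le_between in Hs_sector; apply Rabs_le_between in Ht_sector.
    rewrite re_mult; nra.
Qed.

(** * Coefficients of the solution of a quadratic equation *)

(* The discriminant of [n (1 - X) a^2 + (v X - (2 n - 1/v)) a + (n - 1/v)]. *)
Definition pole_quadratic_disc (n v : C) : ps :=
  ((#v * ps_X - #(2 * n - / v)) * (#v * ps_X - #(2 * n - / v))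
   - #(4 * n * (n - / v)) * (#1 - ps_X))%ps.

Lemma pole_quadratic_disc_factor (n v w : C) :
  v <> 0 -> w <> 0 -> (w + / w = 4 * n * (v + / v) - 4 * n * n - 2)%C ->
  (#v * #v * pole_quadratic_disc n v
   = (#1 - #(w * v * v) * ps_X) * (#1 - #(/ w * v * v) * ps_X))%ps.
Proof.
  intros Hv Hw Ew.
  transitivity (#1 - #((w + / w) * v * v) * ps_X + #(v * v * v * v) * (ps_X * ps_X))%ps.
  - rewrite Ew.
    transitivity (#(v * v * ((2 * n - / v) * (2 * n - / v) - 4 * n * (n - / v)))
      - #(v * v * (2 * v * (2 * n - / v) - 4 * n * (n - / v))) * ps_X
      + #(v * v * v * v) * (ps_X * ps_X))%ps.
    + unfold pole_quadratic_disc; repeat rewrite ?ps_const_mult, ?ps_const_minus; ring.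
    + do 2 f_equal; [f_equal|do 2 f_equal]; now field.
  - transitivity (#1 - (#(w * v * v) + #(/ w * v * v)) * ps_X
                  + #(w * v * v) * #(/ w * v * v) * (ps_X * ps_X))%ps; [|ring].
    rewrite <- ps_const_plus, <- ps_const_mult.
    do 2 f_equal; [do 2 f_equal|f_equal]; now field.
Qed.

Lemma pole_quadratic_disc_sqrt_sum (n : R) (v : C) (a : ps) :
  Cmod v = 1 -> 0 < n <= 2 * Re v ->
  (a * a = #v * #v * pole_quadratic_disc n v)%ps -> a O = 1 ->
  ps_sums a ((2 * Rabs (n - Re v))%R * v)%C.
Proof.
  intros Hv Hn Ha Ha0.
  assert (Hv0 := Cmod_1_neq_0 v Hv).
  destruct (Cmod_1_Re (4 * n * Re v - 2 * n ^ 2 - 1)) as (w & Hw & HRe).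
  { pose proof (Re_le_Cmod v); pose proof (pow2_ge_0 (n - Re v)); split; nra. }
  assert (Hw0 := Cmod_1_neq_0 w Hw).
  assert (Ew : (w + / w = 4 * n * (v + / v) - 4 * n * n - 2)%C).
  { rewrite <- (unit_Re w Hw), <- (unit_Re v Hv), HRe.
    rewrite !RtoC_minus, !RtoC_mult, RtoC_pow; ring. }
  rewrite (pole_quadratic_disc_factor n v w Hv0 Hw0 Ew) in Ha.
  destruct (sqrt_factored_quadratic_sum (w * v * v) (/ w * v * v) a) as (s & Hs & Es & Hs0);
    trivial.
  - rewrite !Cmod_mult, Hw, Hv; lra.
  - rewrite !Cmod_mult, Cmod_inv, Hw, Hv by exact Hw0; lra.
  - replace ((2 * Rabs (n - Re v))%R * v)%C with s; [exact Hs|].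
    apply square_root_unique_Re; [pose proof (Rabs_pos (n - Re v)); lra|lra|exact Hs0|].
    rewrite Es.
    assert (Habs : (Rabs (n - Re v) * Rabs (n - Re v) = (n - Re v) * (n - Re v))%C).
    { rewrite <- !RtoC_mult, <- RtoC_minus, <- RtoC_mult; f_equal; symmetry; apply Rsqr_abs. }
    transitivity (1 - (w + / w) * v * v + v * v * v * v)%C; [now field|].
    transitivity (4 * (Rabs (n - Re v) * Rabs (n - Re v)) * v * v)%C;
      [|rewrite RtoC_mult; ring].
    rewrite Habs, Ew.
    transitivity ((2 * n - 2 * Re v) * (2 * n - 2 * Re v) * v * v)%C; [|ring].
    rewrite unit_Re by exact Hv; now field.
Qed.

Lemma quadratic_coef_limit (n : R) (v : C) (a : ps) :
  Cmod v = 1 -> 0 < n <= 2 * Re v -> a O = 1 ->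
  (#n * (#1 - ps_X) * a * a + (#v * ps_X - #(2 * n - / v)) * a + #(n - / v) = #0)%ps ->
  vanishes (fun k => a k - ((Rabs (n - Re v) + (n - Re v)) / n)%R)%C.
Proof.
  intros Hv Hn Ha0 Ha.
  assert (Hv0 := Cmod_1_neq_0 v Hv).
  assert (Hn0 : RtoC n <> 0) by (apply RtoC_neq_0; lra).
  set (M := (#v * ps_X - #(2 * n - / v))%ps) in *.
  set (root := (#v * (#(2 * n) * (#1 - ps_X) * a + M))%ps).
  assert (Hroot : ps_sums root ((2 * Rabs (n - Re v))%R * v)%C).
  { apply pole_quadratic_disc_sqrt_sum; trivial; unfold root.
    - transitivity (#v * #v * (M * M - #(4 * n * (n - / v)) * (#1 - ps_X))
        + #v * #v * #(4 * n) * (#1 - ps_X) * #0)%ps.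
      + rewrite <- Ha, !ps_const_mult; ring.
      + unfold pole_quadratic_disc; fold M; ring.
    - unfold M, ps_add, ps_sub; rewrite !ps_mul_0, Ha0; simpl; now field. }
  apply ps_sums_mul_one_minus_X.
  replace ((#1 - ps_X) * a)%ps with (#(/ (2 * n * v)) * (root - #v * M))%ps.
  - assert (Elim : (RtoC ((Rabs (n - Re v) + (n - Re v)) / n)
      = / (2 * n * v) * ((2 * Rabs (n - Re v))%R * v - v * (v * 1 - (2 * n - / v))))%C).
    { rewrite RtoC_div, RtoC_plus, RtoC_minus, RtoC_mult by lra.
      transitivity ((2 * Rabs (n - Re v) + (2 * n - (v + / v))) / (2 * n))%C; [|now field].
      rewrite <- unit_Re by exact Hv; now field. }
    rewrite Elim; apply ps_sums_const_mul, ps_sums_sub, ps_sums_const_mul, ps_sums_sub;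
      [exact Hroot|apply ps_sums_const_mul, ps_sums_X|apply ps_sums_const].
  - transitivity (#(/ (2 * n * v)) * (#v * #(2 * n)) * ((#1 - ps_X) * a))%ps;
      [unfold root; ring|].
    rewrite <- !ps_const_mult.
    replace (/ (2 * n * v) * (v * (2 * n)))%C with (RtoC 1) by (now field); ring.
Qed.

(** * The parameters of the walk *)

Lemma Cnorm2_Cmod (z : C) : Cnorm2 z = Cmod z ^ 2.
Proof. rewrite Cmod2_alt; unfold Cnorm2, Re, Im; ring. Qed.

Lemma Defs_Cmod_eq (z : C) : Defs.Cmod z = Cmod z.
Proof. unfold Defs.Cmod, Cmod, Cnorm2; f_equal; ring. Qed.

Lemma Defs_Cdiv_eq (z w : C) : Defs.Cdiv z w = (z / w)%C.
Proof.
  unfold Defs.Cdiv, Defs.Cinv, Cdiv, Cinv; rewrite Cnorm2_Cmod, Cmod2_alt; reflexivity.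
Qed.

Lemma Cmod_Cexpi (theta : R) : Cmod (Cexpi theta) = 1.
Proof.
  unfold Cmod, Cexpi; rewrite <- sqrt_1; f_equal; cbn [fst snd].
  rewrite <- (sin2_cos2 theta); unfold Rsqr; ring.
Qed.

Lemma Cexpi_opp (theta : R) : Cexpi (- theta) = (/ Cexpi theta)%C.
Proof.
  rewrite <- Cconj_unit by apply Cmod_Cexpi.
  unfold Cexpi, Cconj; now rewrite cos_neg, sin_neg.
Qed.

Lemma sgn_mult_Rabs (x : R) : sgn x * Rabs x = x.
Proof.
  unfold sgn; destruct (Rlt_dec 0 x); [|destruct (Rlt_dec x 0)].
  - rewrite Rabs_pos_eq; lra.
  - rewrite Rabs_left; lra.
  - lra.
Qed.

Lemma Cmod_1_plus_sqr (b : C) : Cmod (1 + b) ^ 2 = 1 + 2 * Re b + Cmod b ^ 2.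
Proof.
  rewrite !Cmod2_alt, re_plus, im_plus, re_RtoC, im_RtoC; ring.
Qed.

Lemma one_plus_neq_0 (b : C) : Cmod b < 1 -> (1 + b <> 0)%C.
Proof.
  intros Hb E; apply (f_equal Re) in E; rewrite re_plus, !re_RtoC in E.
  pose proof (re_le_Cmod b) as HRe; apply Rabs_le_between in HRe; lra.
Qed.

Lemma Re_unit_dir_bounds (b : C) :
  Cmod b < 1 -> 0 < Cmod (1 + b) <= 2 * Re (unit_dir (1 + b)).
Proof.
  intro Hb; pose proof (one_plus_neq_0 b Hb) as Hn; apply Cmod_gt_0 in Hn.
  split; [exact Hn|].
  unfold unit_dir; rewrite re_scal_l, re_plus, re_RtoC.
  apply (Rmult_le_reg_l (Cmod (1 + b))); [exact Hn|].
  replace (_ * (2 * _)) with (2 * (1 + Re b)) by (field; lra).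
  pose proof (Cmod_1_plus_sqr b); pose proof (Cmod_ge_0 b); nra.
Qed.

Lemma Mb_eq (b : C) :
  Cmod b < 1 ->
  let n := Cmod (1 + b) in
  let p := Re (unit_dir (1 + b)) in
  Mb b = (Rabs (n - p) + (n - p)) / n.
Proof.
  intros Hb n p; pose proof (one_plus_neq_0 b Hb) as Hn; apply Cmod_gt_0 in Hn; fold n in Hn.
  assert (Es : Cnorm2 b + Cre b = n * (n - p)).
  { unfold p, unit_dir; rewrite re_scal_l, re_plus, re_RtoC, Cnorm2_Cmod; fold n.
    transitivity (n ^ 2 - (1 + Re b)); [unfold n; rewrite Cmod_1_plus_sqr; unfold Re, Cre; ring|].
    field; lra. }
  unfold Mb; cbv zeta; set (s := Cnorm2 b + Cre b) in *.
  rewrite Defs_Cmod_eq, Defs_Cdiv_eq.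
  change (Cmul (Cadd Defs.C1 b) (Cadd Defs.C1 b)) with ((1 + b) * (1 + b))%C.
  rewrite Cmod_div, Cmod_mult by (now apply Cmult_neq_0; apply one_plus_neq_0).
  change (Defs.RtoC s) with (RtoC s); rewrite Cmod_R; fold n.
  transitivity ((Rabs s + sgn s * Rabs s) / (n * n)); [field; lra|].
  rewrite sgn_mult_Rabs, Es, Rabs_mult, (Rabs_pos_eq n) by lra.
  field; lra.
Qed.

Lemma nuII_sqr (b : C) : Cmod b < 1 -> nuII b ^ 2 = (1 - Cmod b ^ 2) / Cmod (1 + b) ^ 2.
Proof.
  intro Hb; pose proof (one_plus_neq_0 b Hb) as Hn; apply Cmod_gt_0 in Hn.
  unfold nuII, rho; rewrite Defs_Cmod_eq, Cnorm2_Cmod; change (Cadd Defs.C1 b) with (1 + b)%C.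
  rewrite <- (pow2_sqrt (1 - Cmod b ^ 2)) at 2 by (pose proof (Cmod_ge_0 b); nra).
  field; lra.
Qed.

Lemma unitary2_second_row (cRR cLR cRL cLL : C) :
  unitary2 cRR cLR cRL cLL ->
  let Delta := detU cRR cLR cRL cLL in
  Cmod cRR ^ 2 + Cmod cLR ^ 2 = 1 /\ Cmod Delta = 1 /\
  cRL = (- (Delta * Cconj cLR))%C /\ cLL = (Delta * Cconj cRR)%C.
Proof.
  intros (_ & _ & _ & Hrow1 & Hrow2 & Horth) Delta.
  change (cRR * Cconj cRR + cLR * Cconj cLR = 1)%C in Hrow1.
  change (cRL * Cconj cRL + cLL * Cconj cLL = 1)%C in Hrow2.
  change (cRR * Cconj cRL + cLR * Cconj cLL = 0)%C in Horth.
  apply (f_equal Cconj) in Horth; rewrite Cplus_conj, !Cmult_conj, !Cconj_conj in Horth.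
  rewrite Cconj_RtoC in Horth.
  assert (EDelta : Delta = (cRR * cLL - cLR * cRL)%C) by reflexivity; clearbody Delta.
  assert (HRL : cRL = (- (Delta * Cconj cLR))%C).
  { transitivity (cRL * (cRR * Cconj cRR + cLR * Cconj cLR)
                  - cRR * (Cconj cRR * cRL + Cconj cLR * cLL))%C;
      [rewrite Hrow1, Horth|rewrite EDelta]; ring. }
  assert (HLL : cLL = (Delta * Cconj cRR)%C).
  { transitivity (cLL * (cRR * Cconj cRR + cLR * Cconj cLR)
                  - cLR * (Cconj cRR * cRL + Cconj cLR * cLL))%C;
      [rewrite Hrow1, Horth|rewrite EDelta]; ring. }
  rewrite <- !Cmod2_conj, <- RtoC_plus in Hrow1, Hrow2.
  apply RtoC_inj in Hrow1; apply RtoC_inj in Hrow2.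
  repeat split; try assumption.
  rewrite HRL, HLL, Cmod_opp, !Cmod_mult, !Cmod_conj in Hrow2.
  apply Rsqr_inj; [apply Cmod_ge_0|lra|]; unfold Rsqr.
  transitivity (Cmod Delta ^ 2 * (Cmod cRR ^ 2 + Cmod cLR ^ 2)); [rewrite Hrow1|]; lra.
Qed.

(** * The walk *)

Section TypeIIWalk.

Variables (cRR cLR cRL cLL : C) (gamma delta : R).

Let Delta : C := detU cRR cLR cRL cLL.
Let g : C := Cexpi gamma.
Let omega : C := Cexpi delta.
Let b : C := bII cRR cLR cRL cLL gamma.

Definition ampR (x : nat) : ps := fun t => fst (psiII cRR cLR cRL cLL gamma delta t) x.
Definition ampL (x : nat) : ps := fun t => snd (psiII cRR cLR cRL cLL gamma delta t) x.

Lemma ampR_0 (t : nat) : ampR 0 t = 0.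
Proof.
  destruct t as [|t]; [reflexivity|]; unfold ampR, psiII; rewrite Nat.iter_succ.
  now destruct (Nat.iter t _ _).
Qed.

Lemma ampR_1_S (t : nat) : ampR 1 (S t) = (g * ampL 0 t)%C.
Proof.
  unfold ampR, ampL, psiII; rewrite Nat.iter_succ; now destruct (Nat.iter t _ _).
Qed.

Lemma ampR_SS_S (x t : nat) :
  ampR (S (S x)) (S t) = (cRR * ampR (S x) t + cRL * ampL (S x) t)%C.
Proof.
  unfold ampR, ampL, psiII; rewrite Nat.iter_succ; now destruct (Nat.iter t _ _).
Qed.

Lemma ampL_S (x t : nat) :
  ampL x (S t) = (cLR * ampR (S x) t + cLL * ampL (S x) t)%C.
Proof.
  unfold ampR, ampL, psiII; rewrite Nat.iter_succ; now destruct (Nat.iter t _ _).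
Qed.

Lemma amp_light_cone (t x : nat) : (t < x)%nat -> ampR x t = 0 /\ ampL x t = 0.
Proof.
  revert x; induction t as [|t IH]; intros [|x] Hx; try lia; [now split|].
  destruct (IH (S (S x)) ltac:(lia)) as [HR HL].
  split; [|rewrite ampL_S, HR, HL; ring].
  destruct x as [|x]; [lia|].
  destruct (IH (S x) ltac:(lia)) as [HR' HL'].
  rewrite ampR_SS_S, HR', HL'; ring.
Qed.

Lemma amp_parity (t x k : nat) : (t + x = S (2 * k))%nat -> ampR x t = 0 /\ ampL x t = 0.
Proof.
  revert x k; induction t as [|t IH]; intros x k Hk.
  - destruct x as [|x]; [lia|now split].
  - split.
    + destruct x as [|[|x]], k as [|k]; try lia; try apply ampR_0.
      * destruct (IH O k ltac:(lia)) as [_ HL]; rewrite ampR_1_S, HL; ring.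
      * destruct (IH (S x) k ltac:(lia)) as [HR HL]; rewrite ampR_SS_S, HR, HL; ring.
    + destruct (IH (S x) k ltac:(lia)) as [HR HL]; rewrite ampL_S, HR, HL; ring.
Qed.

Lemma ampR_1_series : (ampR 1 = ps_X * (#g * ampL 0))%ps.
Proof.
  apply ps_ext; intros [|t]; [now rewrite ps_X_mul_0|].
  now rewrite ps_X_mul_S, ps_const_mul, ampR_1_S.
Qed.

Lemma ampR_SS_series (x : nat) :
  (ampR (S (S x)) = ps_X * (#cRR * ampR (S x) + #cRL * ampL (S x)))%ps.
Proof.
  apply ps_ext; intros [|t]; [now rewrite ps_X_mul_0|].
  rewrite ps_X_mul_S; unfold ps_add; now rewrite !ps_const_mul, ampR_SS_S.
Qed.

Lemma ampL_series (x : nat) :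
  (ampL x - #(ampL x O) = ps_X * (#cLR * ampR (S x) + #cLL * ampL (S x)))%ps.
Proof.
  apply ps_ext; intros [|t]; unfold ps_sub.
  - rewrite ps_X_mul_0; simpl; ring.
  - rewrite ps_X_mul_S; unfold ps_add; rewrite !ps_const_mul, ampL_S; simpl; ring.
Qed.

Lemma ampL_S_series (x : nat) :
  (ampL (S x) = ps_X * (#cLR * ampR (S (S x)) + #cLL * ampL (S (S x))))%ps.
Proof. rewrite <- ampL_series; change (ampL (S x) O) with (RtoC 0); ring. Qed.

Definition wronskian (x : nat) : ps :=
  (ampR (S x) * ampL (S x) - ampR (S (S x)) * (ampL x - #(ampL x O)))%ps.

Lemma wronskian_S (x : nat) : (#cLL * wronskian (S x) = #cRR * wronskian x)%ps.
Proof.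
  assert (Ewx : wronskian x = (ps_X * #cLL * (ampR (S x) * ampL (S (S x))
                                              - ampL (S x) * ampR (S (S x))))%ps).
  { unfold wronskian; rewrite ampL_series, (ampL_S_series x); ring. }
  assert (EwSx : wronskian (S x) = (ps_X * #cRR * (ampR (S x) * ampL (S (S x))
                                                   - ampL (S x) * ampR (S (S x))))%ps).
  { unfold wronskian; change (ampL (S x) O) with (RtoC 0).
    rewrite (ampR_SS_series x), (ampR_SS_series (S x)), (ampR_SS_series x); ring. }
  rewrite Ewx, EwSx; ring.
Qed.

(* The Wronskian is geometric in [x], yet its [m]-th coefficient vanishes once [x >= m]. *)
Lemma wronskian_eq_0 (x : nat) : cRR <> 0 -> (wronskian x = #0)%ps.
Proof.
  intro Hc; apply ps_ext; intro m; transitivity (RtoC 0); [|now destruct m].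
  assert (H : forall k y, (m <= y + k)%nat -> wronskian y m = 0).
  { induction k as [|k IH]; intros y Hy.
    - unfold wronskian, ps_sub; rewrite !ps_mul_low_order; [ring| |];
        intros i Hi; apply amp_light_cone; lia.
    - apply (Cmult_eq_reg_l cRR); [exact Hc|].
      rewrite <- ps_const_mul, <- wronskian_S, ps_const_mul, IH by lia; ring. }
  apply (H m); lia.
Qed.

Hypothesis coin_unitary : unitary2 cRR cLR cRL cLL.
Hypothesis cRR_neq_0 : cRR <> 0.

Lemma Cmod_Delta : Cmod Delta = 1.
Proof. now destruct (unitary2_second_row _ _ _ _ coin_unitary) as (_ & HDelta & _). Qed.

Lemma Delta_neq_0 : Delta <> 0.
Proof. exact (Cmod_1_neq_0 _ Cmod_Delta). Qed.

Lemma g_neq_0 : g <> 0.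
Proof. exact (Cmod_1_neq_0 _ (Cmod_Cexpi gamma)). Qed.

Lemma omega_neq_0 : omega <> 0.
Proof. exact (Cmod_1_neq_0 _ (Cmod_Cexpi delta)). Qed.

Lemma cLL_eq : cLL = (Delta * Cconj cRR)%C.
Proof. now destruct (unitary2_second_row _ _ _ _ coin_unitary) as (_ & _ & _ & HLL). Qed.

Lemma cLL_neq_0 : cLL <> 0.
Proof.
  rewrite cLL_eq; apply Cmult_neq_0; [exact Delta_neq_0|].
  apply Cmod_gt_0; rewrite Cmod_conj; now apply Cmod_gt_0.
Qed.

Lemma bII_eq : b = (Cconj cLR * Delta / g)%C.
Proof. unfold Cdiv, g; rewrite <- Cexpi_opp; reflexivity. Qed.

Lemma cRL_eq : cRL = (- (b * g))%C.
Proof.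
  destruct (unitary2_second_row _ _ _ _ coin_unitary) as (_ & _ & HRL & _).
  rewrite bII_eq, HRL at 1; fold Delta; field; exact g_neq_0.
Qed.

Lemma cLR_eq : (cLR * g = Delta * Cconj b)%C.
Proof.
  rewrite bII_eq, Cdiv_conj, Cmult_conj, Cconj_conj by exact g_neq_0.
  rewrite (Cconj_unit g (Cmod_Cexpi gamma)), (Cconj_unit Delta Cmod_Delta).
  field; split; [exact g_neq_0|exact Delta_neq_0].
Qed.

Lemma Cmod_b_sqr : Cmod b ^ 2 = 1 - Cmod cRR ^ 2.
Proof.
  destruct (unitary2_second_row _ _ _ _ coin_unitary) as (Hrow & _).
  rewrite bII_eq, Cmod_div, Cmod_mult, Cmod_conj, Cmod_Delta by exact g_neq_0.
  unfold g; rewrite Cmod_Cexpi; unfold Rdiv; rewrite Rinv_1; lra.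
Qed.

Lemma Cmod_b_lt_1 : Cmod b < 1.
Proof.
  pose proof Cmod_b_sqr; pose proof (Cmod_ge_0 b).
  pose proof (proj1 (Cmod_gt_0 _) cRR_neq_0); nra.
Qed.

Lemma ampL_0_quadratic :
  let A := ampL 0 in
  let A' := (A - #omega)%ps in
  (A * A' + #b * (A' * A')
   - #Delta * (ps_X * (ps_X * (A * A' + #(Cconj b) * (A * A)))) = #0)%ps.
Proof.
  intros A A'.
  assert (ER1 := ampR_1_series); assert (ER2 := ampR_SS_series 0).
  assert (EA' := ampL_series 0); assert (Hwronskian := wronskian_eq_0 0 cRR_neq_0).
  unfold wronskian in Hwronskian; change (ampL 0 O) with omega in EA', Hwronskian.
  fold A in ER1, EA', Hwronskian; fold A' in EA', Hwronskian.
  set (R1 := ampR 1) in *; set (R2 := ampR 2) in *; set (L1 := ampL 1) in *.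
  assert (EL1 : (ps_X * #cLL * L1 = A' - ps_X * #cLR * R1)%ps) by (rewrite EA'; ring).
  assert (ER1A' : (R1 * (A' - ps_X * #cLR * R1)
                   = ps_X * (ps_X * #Delta * R1 + #cRL * A') * A')%ps).
  { rewrite <- EL1.
    transitivity (ps_X * #cLL * (R1 * L1 - R2 * A') + ps_X * #cLL * R2 * A')%ps; [ring|].
    rewrite Hwronskian, ER2.
    transitivity (ps_X * (ps_X * #cLL * #cRR * R1 + #cRL * (ps_X * #cLL * L1)) * A')%ps; [ring|].
    rewrite EL1; change Delta with (cRR * cLL - cLR * cRL)%C.
    rewrite ps_const_minus, !ps_const_mult; ring. }
  apply (ps_mul_cancel_l (ps_const g)); [exact g_neq_0|]; apply ps_X_mul_cancel.
  transitivity (R1 * (A' - ps_X * #cLR * R1)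
                - ps_X * (ps_X * #Delta * R1 + #cRL * A') * A')%ps; [|rewrite ER1A'; ring].
  rewrite cRL_eq, ER1.
  transitivity (ps_X * (#g * A) * (A' - ps_X * (ps_X * (#(cLR * g) * A)))
    - ps_X * (ps_X * #Delta * (ps_X * (#g * A)) + #(- (b * g)) * A') * A')%ps;
    [rewrite cLR_eq|]; rewrite ?ps_const_opp, !ps_const_mult; ring.
Qed.

Let n : R := Cmod (1 + b).
Let v : C := unit_dir (1 + b).
Let mu : C := (Delta / (v * v))%C.

Lemma Cmod_v : Cmod v = 1.
Proof. exact (Cmod_unit_dir _ (one_plus_neq_0 b Cmod_b_lt_1)). Qed.

Lemma v_neq_0 : v <> 0.
Proof. exact (Cmod_1_neq_0 _ Cmod_v). Qed.

Lemma one_plus_b_polar : (1 + b = n * v)%C.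
Proof. exact (unit_dir_polar _ (one_plus_neq_0 b Cmod_b_lt_1)). Qed.

Lemma one_plus_Cconj_b_polar : (1 + Cconj b = n / v)%C.
Proof.
  transitivity (Cconj (1 + b)).
  - now rewrite Cplus_conj, Cconj_RtoC.
  - now rewrite one_plus_b_polar, Cmult_conj, Cconj_RtoC, (Cconj_unit v Cmod_v).
Qed.

Lemma Cmod_mu : Cmod mu = 1.
Proof.
  unfold mu; rewrite Cmod_div, Cmod_mult, Cmod_Delta, Cmod_v
    by (apply Cmult_neq_0; exact v_neq_0); field.
Qed.

Lemma mu_neq_0 : mu <> 0.
Proof. exact (Cmod_1_neq_0 _ Cmod_mu). Qed.

Definition normalized_ampL_0 : ps := (#(/ omega) * ampL 0)%ps.

Lemma normalized_ampL_0_quadratic :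
  let B := normalized_ampL_0 in
  (#(1 + b) * (B * B) - #(1 + 2 * b) * B + #b
   - ps_X * (ps_X * (#(Delta * (1 + Cconj b)) * (B * B) - #Delta * B)) = #0)%ps.
Proof.
  intro B; transitivity (#(/ omega) * #(/ omega) * #0)%ps; [|ring].
  assert (Eomega : (#(/ omega) * #omega = #1)%ps)
    by (rewrite <- ps_const_mult; f_equal; field; exact omega_neq_0).
  assert (EB : (#(/ omega) * (ampL 0 - #omega) = B - #1)%ps)
    by (rewrite <- Eomega; unfold B, normalized_ampL_0; ring).
  rewrite <- ampL_0_quadratic.
  transitivity (B * (B - #1) + #b * ((B - #1) * (B - #1))
    - #Delta * (ps_X * (ps_X * (B * (B - #1) + #(Cconj b) * (B * B)))))%ps.
  - rewrite !ps_const_plus, !ps_const_mult, ps_const_plus; ring.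
  - rewrite <- EB; unfold B, normalized_ampL_0; ring.
Qed.

(* The generating function of the return amplitudes in the variable [X = mu z^2]. *)
Definition return_series : ps := ps_dilate (/ mu) (ps_even_part normalized_ampL_0).

Lemma return_series_quadratic :
  let a := return_series in
  (#n * (#1 - ps_X) * a * a + (#v * ps_X - #(2 * n - / v)) * a + #(n - / v) = #0)%ps.
Proof.
  intro a.
  assert (Hodd : forall k, normalized_ampL_0 (S (2 * k)) = 0).
  { intro k; unfold normalized_ampL_0; rewrite ps_const_mul.
    rewrite (proj2 (amp_parity (S (2 * k)) 0 k ltac:(lia))); ring. }
  assert (Ha := f_equal (ps_dilate (/ mu))
                  (ps_even_part_quadratic _ _ _ _ _ _ Hodd normalized_ampL_0_quadratic)).
  repeat rewrite ?ps_dilate_sub, ?ps_dilate_add, ?ps_dilate_mul, ?ps_dilate_const,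
    ?ps_dilate_X in Ha.
  fold return_series a in Ha.
  assert (Hv := v_neq_0); assert (HDelta := Delta_neq_0).
  assert (Eb : b = (v * (n - / v))%C)
    by (transitivity (1 + b - 1)%C; [ring|rewrite one_plus_b_polar; now field]).
  assert (Esqr : (1 + b = v * n)%C) by (rewrite one_plus_b_polar; ring).
  assert (Elin : (1 + 2 * b = v * (2 * n - / v))%C) by (rewrite Eb; now field).
  assert (EXsqr : (/ mu * (Delta * (1 + Cconj b)) = v * n)%C)
    by (rewrite one_plus_Cconj_b_polar; unfold mu; now field).
  assert (EXlin : (/ mu * Delta = v * v)%C) by (unfold mu; now field).
  apply (ps_mul_cancel_l (ps_const v)); [exact Hv|].
  transitivity (#0)%ps; [rewrite <- Ha|ring].
  transitivity (#(1 + b) * (a * a) - #(1 + 2 * b) * a + #b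
    - ps_X * (#(/ mu * (Delta * (1 + Cconj b))) * (a * a) - #(/ mu * Delta) * a))%ps.
  - rewrite EXsqr, EXlin, Esqr, Elin, Eb at 1; rewrite !ps_const_mult; ring.
  - rewrite !ps_const_mult; ring.
Qed.

Lemma ampL_0_even (k : nat) : ampL 0 (2 * k)%nat = (omega * mu ^ k * return_series k)%C.
Proof.
  unfold return_series, normalized_ampL_0, ps_dilate, ps_even_part; rewrite ps_const_mul.
  rewrite Cpow_inv by exact mu_neq_0; field.
  split; [exact omega_neq_0|apply Cpow_nz, mu_neq_0].
Qed.

Let limit_amp : nat -> C := even_geom (omega * Mb b) mu.

Lemma ampL_0_asymptotic : vanishes (fun t => ampL 0 t - limit_amp t)%C.
Proof.
  assert (Hret : vanishes (fun k => return_series k - Mb b)%C).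
  { rewrite (Mb_eq b Cmod_b_lt_1).
    apply (quadratic_coef_limit n v); [exact Cmod_v|exact (Re_unit_dir_bounds b Cmod_b_lt_1)| |].
    - apply (Cmult_eq_reg_l omega); [exact omega_neq_0|].
      transitivity (omega * mu ^ 0 * return_series O)%C; [simpl; ring|].
      rewrite <- (ampL_0_even O); change (omega = omega * 1)%C; ring.
    - exact return_series_quadratic. }
  apply vanishes_even; unfold limit_amp.
  - intro k; rewrite even_geom_odd, (proj2 (amp_parity (S (2 * k)) 0 k ltac:(lia))); ring.
  - apply is_lim_seq_ext with (2 := Hret); intro k.
    rewrite ampL_0_even, even_geom_double.
    transitivity (Cmod (omega * mu ^ k * (return_series k - Mb b))); [|f_equal; ring].
    unfold omega; rewrite !Cmod_mult, Cmod_pow, Cmod_mu, Cmod_Cexpi, pow1; ring.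
Qed.

Let kappa : C := (cRR / (1 + b))%C.

Lemma kappa_step_R : (cRR * g + cRL * kappa = g * kappa)%C.
Proof. rewrite cRL_eq; unfold kappa; field; exact (one_plus_neq_0 b Cmod_b_lt_1). Qed.

Lemma kappa_step_L : (mu - cLR * g = cLL * kappa)%C.
Proof.
  rewrite cLR_eq, cLL_eq; unfold kappa, mu.
  assert (Hv0 := v_neq_0); assert (Hb0 := one_plus_neq_0 b Cmod_b_lt_1).
  assert (HRR : (Cconj cRR * cRR = 1 - b * Cconj b)%C).
  { rewrite Cmult_comm, <- !Cmod2_conj, Cmod_b_sqr, RtoC_minus; ring. }
  assert (Hvv : (/ (v * v) = (1 + Cconj b) / (1 + b))%C).
  { rewrite one_plus_Cconj_b_polar, one_plus_b_polar; field.
    split; [exact Hv0|apply RtoC_neq_0, Rgt_not_eq, Cmod_gt_0, Hb0]. }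
  transitivity (Delta * (/ (v * v) - Cconj b))%C; [now field|].
  transitivity (Delta * (Cconj cRR * cRR) / (1 + b))%C; [|now field].
  rewrite Hvv, HRR; now field.
Qed.

(* [kappa] and [mu] make the claimed limits satisfy the step relations exactly; as [cLL] is
   invertible, these relations determine the amplitudes at the next site. *)
Lemma amp_asymptotic (x : nat) :
  vanishes (fun t => ampR (S x) (t + S x)%nat - g * kappa ^ x * limit_amp t)%C /\
  vanishes (fun t => ampL x (t + x)%nat - kappa ^ x * limit_amp t)%C.
Proof.
  induction x as [|x [IHR IHL]].
  - split.
    + apply (vanishes_ext (fun t => g * (ampL 0 t - limit_amp t))%C).
      * intro t; rewrite Nat.add_1_r, ampR_1_S; simpl; ring.
      * apply vanishes_mul_l, ampL_0_asymptotic.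
    + apply (vanishes_ext (fun t => ampL 0 t - limit_amp t)%C); [|exact ampL_0_asymptotic].
      intro t; rewrite Nat.add_0_r; simpl; ring.
  - assert (HLL := cLL_neq_0).
    assert (HL : vanishes (fun t => ampL (S x) (t + S x)%nat - kappa ^ S x * limit_amp t)%C).
    { apply (vanishes_ext (fun t => / cLL *
        ((ampL x (S (S t) + x)%nat - kappa ^ x * limit_amp (S (S t)))
         + - cLR * (ampR (S x) (t + S x)%nat - g * kappa ^ x * limit_amp t)))%C).
      - intro t; replace (S (S t) + x)%nat with (S (t + S x)) by lia.
        rewrite ampL_S; unfold limit_amp; rewrite even_geom_SS; fold limit_amp.
        transitivity (ampL (S x) (t + S x)%nat
          - (/ cLL * (mu - cLR * g)) * kappa ^ x * limit_amp t)%C; [now field|].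
        rewrite kappa_step_L; simpl; now field.
      - apply vanishes_mul_l, vanishes_plus; [|now apply vanishes_mul_l].
        apply is_lim_seq_incr_1 in IHL; apply is_lim_seq_incr_1 in IHL; exact IHL. }
    split; [|exact HL].
    apply (vanishes_ext (fun t => cRR * (ampR (S x) (t + S x)%nat - g * kappa ^ x * limit_amp t)
      + cRL * (ampL (S x) (t + S x)%nat - kappa ^ S x * limit_amp t))%C).
    + intro t; replace (t + S (S x))%nat with (S (t + S x)) by lia; rewrite ampR_SS_S.
      transitivity (cRR * ampR (S x) (t + S x)%nat + cRL * ampL (S x) (t + S x)%nat
        - (cRR * g + cRL * kappa) * kappa ^ x * limit_amp t)%C; [simpl; ring|].
      rewrite kappa_step_R; simpl; ring.
    + now apply vanishes_plus; apply vanishes_mul_l.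
Qed.

Lemma Cmod_kappa_sqr : Cmod kappa ^ 2 = nuII b ^ 2.
Proof.
  rewrite nuII_sqr, Cmod_b_sqr by exact Cmod_b_lt_1; unfold kappa.
  assert (Hb0 := one_plus_neq_0 b Cmod_b_lt_1).
  rewrite Cmod_div by exact Hb0; apply Cmod_gt_0 in Hb0; field; lra.
Qed.

Lemma Cmod_kappa_pow_sqr (x : nat) : Cmod (kappa ^ x) ^ 2 = nuII b ^ (2 * x).
Proof. now rewrite Cmod_pow, <- pow_mult, Nat.mul_comm, !pow_mult, Cmod_kappa_sqr. Qed.

Lemma Cmod_limit_amp_sqr (t : nat) :
  Cmod (limit_amp t) ^ 2 = (1 + (-1) ^ t) / 2 * Rabs (Mb b) ^ 2.
Proof.
  unfold limit_amp; rewrite Cmod_even_geom_sqr by exact Cmod_mu; unfold omega.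
  rewrite Cmod_mult, Cmod_Cexpi, Cmod_R; ring.
Qed.

Lemma limII_0 (t : nat) : limII b t 0 = Cmod (limit_amp t) ^ 2.
Proof. now rewrite Cmod_limit_amp_sqr. Qed.

Lemma limII_S (t x : nat) :
  limII b (t + S x) (S x)
  = Cmod (g * kappa ^ x * limit_amp t) ^ 2 + Cmod (kappa ^ S x * limit_amp t) ^ 2.
Proof.
  assert (Hnu : nuII b <> 0%R).
  { intro Enu; assert (Hkappa := Cmod_kappa_sqr); revert Hkappa; rewrite Enu.
    assert (Hb0 := one_plus_neq_0 b Cmod_b_lt_1).
    unfold kappa; rewrite Cmod_div by exact Hb0; apply Cmod_gt_0 in Hb0.
    assert (HRR := proj1 (Cmod_gt_0 cRR) cRR_neq_0).
    pose proof (Rdiv_lt_0_compat _ _ HRR Hb0); nra. }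
  rewrite !Cmod_mult, !Rpow_mult_distr, !Cmod_kappa_pow_sqr, Cmod_limit_amp_sqr.
  unfold g; rewrite Cmod_Cexpi; unfold limII.
  replace (S x + (t + S x))%nat with (t + 2 * S x)%nat by lia.
  rewrite pow_add, pow_1_even; replace (2 * S x)%nat with (2 + 2 * x)%nat by lia.
  rewrite pow_add; field; exact Hnu.
Qed.

Lemma Cmod_sqr_asymptotic_limit_amp (c : C) (f : nat -> C) :
  vanishes (fun t => f t - c * limit_amp t)%C ->
  is_lim_seq (fun t => Cmod (f t) ^ 2 - Cmod (c * limit_amp t) ^ 2) 0.
Proof.
  intro Hf; apply (Cmod_sqr_asymptotic _ _ (Cmod c * Cmod (omega * Mb b)) Hf).
  intro t; rewrite Cmod_mult; apply Rmult_le_compat_l; [apply Cmod_ge_0|].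
  apply Cmod_even_geom_le, Cmod_mu.
Qed.

Lemma probII_0 (t : nat) :
  probII cRR cLR cRL cLL gamma delta t 0 = Cmod (ampL 0 t) ^ 2.
Proof.
  unfold probII, ampL; destruct (psiII _ _ _ _ _ _ t) as [pR pL]; apply Cnorm2_Cmod.
Qed.

Lemma probII_S (t x : nat) :
  probII cRR cLR cRL cLL gamma delta t (S x) = Cmod (ampR (S x) t) ^ 2 + Cmod (ampL (S x) t) ^ 2.
Proof.
  unfold probII, ampR, ampL; destruct (psiII _ _ _ _ _ _ t) as [pR pL].
  now rewrite !Cnorm2_Cmod.
Qed.

Lemma probII_asymptotic_0 :
  is_lim_seq (fun t => probII cRR cLR cRL cLL gamma delta t 0 - limII b t 0) 0.
Proof.
  destruct (amp_asymptotic 0) as [_ HL].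
  apply is_lim_seq_ext with (2 := Cmod_sqr_asymptotic_limit_amp _ _ HL); intro t.
  rewrite probII_0, limII_0, Nat.add_0_r; do 3 f_equal; simpl; ring.
Qed.

Lemma probII_asymptotic_S (x : nat) :
  is_lim_seq (fun t => probII cRR cLR cRL cLL gamma delta t (S x) - limII b t (S x)) 0.
Proof.
  destruct (amp_asymptotic x) as [HR _]; destruct (amp_asymptotic (S x)) as [_ HL].
  apply (is_lim_seq_incr_n _ (S x)); rewrite <- (Rplus_0_r 0).
  apply is_lim_seq_ext with (2 := is_lim_seq_plus' _ _ _ _
    (Cmod_sqr_asymptotic_limit_amp _ _ HR) (Cmod_sqr_asymptotic_limit_amp _ _ HL)).
  intro t; rewrite probII_S, limII_S; ring.
Qed.

End TypeIIWalk.

Theorem theorem2 (cRR cLR cRL cLL : Cx) (gamma delta : R) :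
  unitary2 cRR cLR cRL cLL ->
  cRR <> C0 ->
  forall x : nat,
    Un_cv (fun t : nat =>
             probII cRR cLR cRL cLL gamma delta t x
             - limII (bII cRR cLR cRL cLL gamma) t x) 0.
Proof.
  intros Hunitary HRR x; apply is_lim_seq_Reals; destruct x as [|x].
  - now apply probII_asymptotic_0.
  - now apply probII_asymptotic_S.
Qed.
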